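(* Let $0\le m_2\le m_1$ be integers and let $T_{m_1,m_2}$ and $W_{m_1,m_2}$ be the random variables of the card guessing game described in the context. For integers $0\le\ell\le m_1$, $$ \mathbb{P}\{T_{m_1,m_2}=\ell\}= \begin{cases} \dfrac{\binom{m_1+m_2-\ell-1}{m_2-1}+\binom{m_1+m_2-\ell-1}{m_1-1}}{\binom{m_1+m_2}{m_1}}, & m_2,\ell\ge1,\\[2ex] 1, & m_2=0\text{ and }\ell=m_1,\\ 0, & \text{otherwise}, \end{cases} $$ and for integers $0\le k\le m_2$, $$ \mathbb{P}\{W_{m_1,m_2}=k\}= \begin{cases} \dfrac{2^{k}\binom{m_1+m_2-k}{m_1}-2^{k+1}\binom{m_1+m_2-k-1}{m_1}}{\binom{m_1+m_2}{m_1}}, & m_1\ge1,\\[2ex] 1, & m_1=m_2=k=0,\\ 0, & \text{otherwise}. \end{cases} $$ Outside the ranges $0\le\ell\le m_1$ and $0\le k\le m_2$, respectively, the probabilities are zero.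
   Context: Card guessing game: a deck consists of $m_1$ cards of one colour (red) and $m_2$ cards of another colour (black), with integers $0\le m_2\le m_1$, in uniformly random order. The cards are drawn from the top one at a time and discarded until the deck is empty. Before each draw the guesser knows the numbers of remaining red and black cards and guesses the colour of the next card so as to maximize the probability of being correct: the colour with strictly more remaining cards is guessed; if both colours have equally many remaining cards, either colour may be guessed (without information on the order of the remaining cards), with success probability $1/2$. $T_{m_1,m_2}$ is the number of correct guesses made with success probability $p=1$ (i.e. when only one colour remains). $W_{m_1,m_2}$ is the number of times during the process (including the initial state) at which the numbers of remaining red and black cards are equal and non-zero. Convention: $\binom{n}{j}=0$ for integers $j>n\ge 0$. *)

(* Defs.v *)
From mathcomp Require Import all_boot all_order all_algebra all_fingroup.

Set Implicit Arguments.
Unset Strict Implicit.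
Unset Printing Implicit Defensive.

Import GRing.Theory Num.Theory.

Definition prob (S : finType) (E : pred S) : rat :=
  (#|[set x | E x]|%:R / #|S|%:R)%R.

Definition cond_prob (S : finType) (E F : pred S) : rat :=
  (prob (fun x => E x && F x) / prob F)%R.

Definition colour := bool.
Definition red : colour := true.
Definition black : colour := false.

Section Game.

Variables m1 m2 : nat.

(* A shuffled deck [s] lists the cards in drawing order: [s i] is the card
   drawn at step [i], and cards [0, ..., m1 - 1] are the red ones. *)
Definition deck := {perm 'I_(m1 + m2)}.

Implicit Type s : deck.

Definition drawn_colour s (i : 'I_(m1 + m2)) : colour := s i < m1.

(* Number of cards of colour [c] left after the first [t] draws. *)
Definition remaining s (t : nat) (c : colour) : nat :=
  #|[set j : 'I_(m1 + m2) | (t <= j) && (drawn_colour s j == c)]|.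

Definition history s (t : nat) : seq colour :=
  take t [seq drawn_colour s j | j <- enum 'I_(m1 + m2)].

(* How to guess when both colours are equally represented; the rule may use
   the colours already seen, but not the order of the remaining cards. *)
Variable tie : seq colour -> colour.

Definition guess s (i : 'I_(m1 + m2)) : colour :=
  if remaining s i black < remaining s i red then red
  else if remaining s i red < remaining s i black then black
  else tie (history s i).

Definition correct s (i : 'I_(m1 + m2)) : bool := guess s i == drawn_colour s i.

Definition same_counts (i : nat) s s' : bool :=
  (remaining s' i red == remaining s i red) &&
  (remaining s' i black == remaining s i black).

(* Probability that guess [i] is correct given the numbers of red and black
   cards remaining before that draw in the play of [s]. *)
Definition success_prob s (i : 'I_(m1 + m2)) : rat :=
  cond_prob (fun s' => correct s' i) (same_counts i s).

Definition T s : nat :=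
  #|[set i : 'I_(m1 + m2) | correct s i && (success_prob s i == 1%R)]|.

(* Times range over [0, ..., m1 + m2], from the full to the empty deck. *)
Definition W s : nat :=
  #|[set t : 'I_(m1 + m2).+1 |
       (remaining s t red == remaining s t black) && (0 < remaining s t red)]|.

End Game.

(* Main.v *)
Require Import Defs.
From mathcomp Require Import all_boot all_order all_algebra all_fingroup zify.

Set Implicit Arguments.
Unset Strict Implicit.
Unset Printing Implicit Defensive.

Import GRing.Theory Num.Theory.

(** Both random variables depend only on the colours of the cards. Read a deck
    as the word of its colours in drawing order. Permuting the positions of a
    deck permutes the letters of its word, and any two words with m1 red and
    m2 black letters differ by such a permutation; hence all these words are
    equally likely ([prob_colour_word]), and it remains to count words.

    A guess succeeds with probability 1 exactly when one colour is left
    ([sure_guessE]). If one colour is left, every deck with the same counts is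
    guessed correctly. If both are left, exchange the next card with a later
    card whose colour is not the guessed one: the counts and the history, and
    with them the guess, stay the same, but the guess is now wrong. This also
    covers equal counts, whatever the tie-breaking rule is. So T counts the
    nonempty suffixes of the word that have a single colour, and W counts
    those with equally many letters of each colour ([T_word], [W_word]).

    The first letter of a word splits the words with a.+1 red and b.+1 black
    letters into those with (a, b.+1) and those with (a.+1, b) further
    letters, so both counts satisfy recursions of Pascal type.
    - T is the length of the final run. A word with a red and b > 0 black
      letters that ends in exactly l red ones is determined by the letters
      before its last black one, whence 'C(a - l + b - 1, b - 1) such words;
      the other binomial counts the words that end in black
      ([count_one_colour]).
    - For W it is the tail count that is a single term: 2 ^ k * 'C(a + b - k, a)
      words have W >= k, for b <= a ([nb_words_geE]). Off the diagonal the
      recursion is Pascal's rule; on the diagonal the whole word contributes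
      one to W and the two branches are exchanged by swapping the colours,
      which gives the factor 2 and lowers k by one. The law of W is the
      difference of two consecutive tails. *)

(** * Words with given numbers of letters *)

(** The words are listed by recursion on their first letter, so that counting
    in [words a b] unfolds along the same recursion. *)
Fixpoint words (a b : nat) : seq (seq colour) :=
  if a is a'.+1 then
    (fix words_a b := if b is b'.+1 then
       map (cons red) (words a' b) ++ map (cons black) (words_a b')
     else [:: nseq a red]) b
  else [:: nseq b black].

Lemma words0r a : words a 0 = [:: nseq a red].
Proof. by case: a. Qed.

Lemma wordsSS a b :
  words a.+1 b.+1 =
    map (cons red) (words a b.+1) ++ map (cons black) (words a.+1 b).
Proof. by []. Qed.

Lemma words_ind (Q : nat -> nat -> Prop) :
    (forall b, Q 0 b) -> (forall a, Q a.+1 0) ->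
    (forall a b, Q a b.+1 -> Q a.+1 b -> Q a.+1 b.+1) ->
  forall a b, Q a b.
Proof. by move=> Q0 Q1 QS; elim=> // a IHa; elim=> // b IHb; apply: QS. Qed.

Lemma count_mem0_nseq c (w : seq colour) :
  count_mem (~~ c) w = 0 -> w = nseq (count_mem c w) c.
Proof.
elim: w => //= d w IHw; case: eqP => //= d_neq w0; rewrite {1}(IHw w0).
by rewrite (_ : d = c) ?eqxx //; case: c d d_neq {IHw w0} => [] [].
Qed.

Lemma mem_words a b w :
  (w \in words a b) = (count_mem red w == a) && (count_mem black w == b).
Proof.
move: w; elim/words_ind: a / b => [b|a|a b IHr IHb] w.
- rewrite /= inE; apply/eqP/andP => [->|[/eqP r0 /eqP <-]].
    by rewrite !count_nseq /= mul1n eqxx.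
  exact: (@count_mem0_nseq black).
- rewrite words0r inE; apply/eqP/andP => [->|[/eqP <- /eqP b0]].
    by rewrite !count_nseq /= mul1n eqxx.
  exact: (@count_mem0_nseq red).
rewrite wordsSS mem_cat.
have cons_inj c : injective (@cons colour c) by move=> ? ? [].
case: w => [|[] w] /=.
- by apply/orP => -[] /mapP[].
- rewrite mem_map // IHr add0n add1n eqSS orbC; by case: mapP => [[? _ []]|_].
- rewrite mem_map // IHb add0n add1n eqSS; by case: mapP => [[? _ []]|_].
Qed.

Lemma size_in_words a b w : w \in words a b -> size w = a + b.
Proof.
rewrite mem_words => /andP[/eqP <- /eqP <-].
by rewrite -(count_predC (pred1 red)); congr (_ + _); apply: eq_count; case.
Qed.

Lemma words_uniq a b : uniq (words a b).
Proof.
elim/words_ind: a / b => // a b IHr IHb; rewrite wordsSS cat_uniq.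
rewrite !map_inj_uniq ?IHr ?IHb; try by move=> ? ? [].
rewrite andbT; apply/hasPn => w /mapP[v _ ->].
by apply/mapP => -[].
Qed.

Lemma count_wordsSS (P : pred (seq colour)) a b :
  count P (words a.+1 b.+1) =
    count (fun w => P (red :: w)) (words a b.+1)
      + count (fun w => P (black :: w)) (words a.+1 b).
Proof. by rewrite wordsSS count_cat !count_map. Qed.

Lemma count_words0l (P : pred (seq colour)) b :
  count P (words 0 b) = P (nseq b black).
Proof. exact: addn0. Qed.

Lemma count_words0r (P : pred (seq colour)) a :
  count P (words a 0) = P (nseq a red).
Proof. by rewrite words0r; apply: addn0. Qed.

Lemma size_words a b : size (words a b) = 'C(a + b, a).
Proof.
elim/words_ind: a / b => [b|a|a b IHr IHb]; first by rewrite bin0.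
  by rewrite words0r addn0 binn.
rewrite wordsSS size_cat !size_map IHr IHb.
by rewrite [_.+1 + b]addSnnS addSn binS addnC.
Qed.

(** * Statistics that count suffixes *)

(** The suffixes of a word are the states of the play before each draw; the
    empty suffix, which is the end of the play, does not count. *)
Fixpoint nb_suffixes (p : pred (seq colour)) (w : seq colour) : nat :=
  if w is _ :: w' then p w + nb_suffixes p w' else 0.

Lemma nb_suffixesE p w : nb_suffixes p w = \sum_(i < size w) p (drop i w).
Proof.
by elim: w => [|c w IHw]; rewrite ?big_ord0 //= big_ord_recl drop0 IHw.
Qed.

Definition one_colour (w : seq colour) : bool :=
  (count_mem red w == 0) || (count_mem black w == 0).

Definition balanced (w : seq colour) : bool :=
  (count_mem red w == count_mem black w) && (0 < count_mem red w).

Lemma nb_one_colour_nseq n c : nb_suffixes one_colour (nseq n c) = n.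
Proof.
elim: n => //= n ->; rewrite -[c :: _]/(nseq n.+1 c) /one_colour !count_nseq.
by case: c.
Qed.

Lemma nb_balanced_nseq n c : nb_suffixes balanced (nseq n c) = 0.
Proof.
elim: n => //= n ->; rewrite -[c :: _]/(nseq n.+1 c) /balanced !count_nseq.
by case: c.
Qed.

Lemma nb_one_colour_gt0 w : 0 < size w -> 0 < nb_suffixes one_colour w.
Proof.
elim: w => // c [|d w] IHw _; first by case: c.
by rewrite ltn_addl ?IHw.
Qed.

(** * The length of the final run *)

(** The number of words with [a] red and [b] black letters that end in exactly
    [l] red ones. The factor [l <= a] switches off the truncated subtraction. *)
Definition final_run l a b : nat :=
  if b is b'.+1 then (l <= a) * 'C(a - l + b', b') else l == a.

(** Pascal's rule, except at [l = a.+1], where the first summand vanishes and the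
    only word counted starts with all its black letters. *)
Lemma final_runSS l a b :
  final_run l a.+1 b.+1 = final_run l a b.+1 + final_run l a.+1 b.
Proof.
case: b => [|b] /=; first by rewrite !bin0; lia.
case: (ltngtP l a.+1) => [|l_gt|->].
- rewrite ltnS => l_le; rewrite l_le subSn // !mul1n.
  by rewrite [(_ - _).+1 + b]addSnnS addSn binS.
- by rewrite leqNgt (ltnW l_gt).
- by rewrite ltnn subnn !add0n !binn.
Qed.

Lemma final_run_small l a b : a < l -> final_run l a b = 0.
Proof.
case: b => [|b] a_lt /=; first by rewrite gtn_eqF.
by rewrite leqNgt a_lt.
Qed.

(** A nonempty word ends either in a red or in a black run, and its nonempty
    suffixes of a single colour are those of that run. Both sides satisfy the
    same recursion, as a word with letters of both colours is not itself of a
    single colour. For [l = 0] the right-hand side would count the runs of the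
    colour that the word does not end in. *)
Lemma count_one_colour l a b : 0 < l -> 0 < a + b ->
  count (fun w => nb_suffixes one_colour w == l) (words a b) =
    final_run l a b + final_run l b a.
Proof.
move=> l_gt0; elim/words_ind: a / b => [[|b] _|a _|a b IHr IHb _] //.
- rewrite count_words0l nb_one_colour_nseq /=.
  by rewrite [l <= 0]leqNgt l_gt0 eq_sym.
- rewrite count_words0r nb_one_colour_nseq /=.
  by rewrite [l <= 0]leqNgt l_gt0 addn0 eq_sym.
rewrite !final_runSS [final_run l b _ + _]addnC addnACA.
rewrite -IHr ?addnS // -IHb // count_wordsSS; congr (_ + _);
  apply: eq_in_count => w; rewrite mem_words => /andP[/eqP wr /eqP wb];
  by rewrite /one_colour /= ?wr ?wb.
Qed.

(** * The tails of the number of ties *)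

Definition nb_words_ge k a b : nat :=
  count (fun w => k <= nb_suffixes balanced w) (words a b).

(** The whole word is balanced exactly when [a == b]. The truncated subtraction
    is harmless, since every word reaches a threshold of 0. *)
Lemma nb_words_geSS k a b :
  nb_words_ge k a.+1 b.+1 =
    nb_words_ge (k - (a == b)) a b.+1 + nb_words_ge (k - (a == b)) a.+1 b.
Proof.
rewrite /nb_words_ge count_wordsSS; congr (_ + _); apply: eq_in_count => w;
  rewrite mem_words => /andP[/eqP wa /eqP wb] /=;
  rewrite leq_subLR /balanced /= wa wb /= ?add0n ?add1n ?eqSS;
  by rewrite ?ltnS ?leq0n ?andbT.
Qed.

Lemma nb_words_geC k a b : nb_words_ge k a b = nb_words_ge k b a.
Proof.
move: k; elim/words_ind: a / b => [b|a|a b IHr IHb] k.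
- by rewrite /nb_words_ge count_words0l count_words0r !nb_balanced_nseq.
- by rewrite /nb_words_ge count_words0l count_words0r !nb_balanced_nseq.
by rewrite !nb_words_geSS IHr IHb addnC eq_sym.
Qed.

(** Without [0 < a] this fails for [a = b = 0] and positive [k], where the
    truncated [a + b - k] makes the binomial equal to 1. *)
Lemma nb_words_geE k a b : b <= a -> 0 < a ->
  nb_words_ge k a b = 2 ^ k * 'C(a + b - k, a).
Proof.
move: k; elim/words_ind: a / b => [b|a|a b IHr IHb] [|k] b_le_a a_gt0 //.
- by rewrite /nb_words_ge count_words0r addn0 binn.
- rewrite /nb_words_ge count_words0r nb_balanced_nseq.
  by rewrite bin_small ?muln0 //; lia.
- rewrite /nb_words_ge (eq_count (a2 := predT)) // count_predT size_words.
  by rewrite mul1n subn0.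
rewrite ltnS in b_le_a; rewrite nb_words_geSS.
have {}IHb j : nb_words_ge j a.+1 b = 2 ^ j * 'C(a.+1 + b - j, a.+1).
  by rewrite IHb // ltnW.
case: eqVneq => [eq_ab|neq_ab].
  (* On the diagonal both branches have the same count, by colour symmetry. *)
  subst b; rewrite nb_words_geC !IHb.
  by rewrite subn1 /= addnn -mul2n mulnA -expnS [a.+1 + a.+1]addnS subSS.
(* Off the diagonal, [b < a] keeps the branch [(a, b.+1)] in the range. *)
rewrite subn0 IHb IHr; [|lia|lia].
rewrite -mulnDr; congr (_ * _); rewrite !addSn !addnS !subSS.
have [k_le|k_gt] := leqP k (a + b); first by rewrite subSn // binS addnC.
by rewrite !bin_small //; lia.
Qed.

(** * Decks as words *)

Lemma mem_take_enum n t (x : 'I_n) : x \in take t (enum 'I_n) -> x < t.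
Proof.
move=> /(map_f val); rewrite map_take val_enum_ord take_iota mem_iota /= add0n.
by rewrite leq_min => /andP[].
Qed.

Lemma mem_drop_enum n t (x : 'I_n) : x \in drop t (enum 'I_n) -> t <= x.
Proof.
move=> /(map_f val); rewrite map_drop val_enum_ord drop_iota mem_iota.
by case/andP.
Qed.

Lemma card_preim_perm (S : finType) (p : {perm S}) (P : pred S) :
  #|[set x | P (p x)]| = #|[set x | P x]|.
Proof.
rewrite -[RHS](card_preimset _ (@perm_inj _ p)).
by apply: eq_card => x; rewrite !inE.
Qed.

(** The witness [x0] makes the conditioning event nonempty; conditional on an
    empty event the probability is 0 here. *)
Lemma cond_prob1P (S : finType) (E F : pred S) (x0 : S) : F x0 ->
  reflect (forall x, F x -> E x) (cond_prob E F == 1)%R.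
Proof.
move=> Fx0; rewrite /cond_prob /prob.
have sub : [set x | E x && F x] \subset [set x | F x].
  by apply/subsetP => x; rewrite !inE => /andP[].
have S_neq0 : (#|S|%:R != 0 :> rat)%R.
  by rewrite pnatr_eq0 -lt0n; apply/card_gt0P; exists x0.
have F_neq0 : (#|[set x | F x]|%:R != 0 :> rat)%R.
  by rewrite pnatr_eq0 -lt0n; apply/card_gt0P; exists x0; rewrite inE.
rewrite invf_div mulrA divfK // (can2_eq (divfK F_neq0) (mulfK F_neq0)) mul1r.
rewrite eqr_nat (subset_leqif_cards sub).
apply: (iffP eqP) => [/setP EF x Fx|FE].
  by have := EF x; rewrite !inE Fx andbT.
by apply/setP => x; rewrite !inE; case Fx: (F x); rewrite ?andbF ?FE.
Qed.

Section ColourWord.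

Variables m1 m2 : nat.
Implicit Type s : deck m1 m2.

Definition colour_word s : (m1 + m2).-tuple colour :=
  [tuple drawn_colour s i | i < m1 + m2].

Lemma remainingE s t c : remaining s t c = count_mem c (drop t (colour_word s)).
Proof.
rewrite /= -map_drop count_map /remaining cardE {1}/enum_mem size_filter -enumT.
rewrite -[X in count _ X = _](cat_take_drop t) count_cat.
rewrite (@eq_in_count _ _ pred0) => [|x /mem_take_enum x_t]; last first.
  by rewrite !inE leqNgt x_t.
rewrite count_pred0 add0n; apply: eq_in_count => x /mem_drop_enum t_x.
by rewrite !inE t_x.
Qed.

Lemma tnth_colour_word s i : tnth (colour_word s) i = drawn_colour s i.
Proof. by rewrite tnth_mktuple. Qed.

Lemma count_colour_word s :
  (count_mem red (colour_word s) == m1)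
    && (count_mem black (colour_word s) == m2).
Proof.
have red_m1 : count_mem red (colour_word s) = m1.
  rewrite -[tval _]drop0 -remainingE /remaining.
  transitivity #|[set x : 'I_(m1 + m2) | x < m1]|.
    rewrite -[RHS](card_preim_perm s); apply: eq_card => x.
    by rewrite !inE /drawn_colour; case: (s x < m1).
  rewrite -[RHS]card_ord -(card_imset _ (@lshift_inj m1 m2)).
  apply: eq_card => x; rewrite inE.
  apply/idP/imsetP => [x_lt|[y _ ->]]; last exact: (valP y).
  by exists (Ordinal x_lt) => //; apply: val_inj.
rewrite red_m1 eqxx /=; have := count_predC (pred1 red) (colour_word s).
rewrite red_m1 size_tuple => /addnI black_m2.
by apply/eqP; rewrite -[RHS]black_m2; apply: eq_count; case.
Qed.

(** * Sure guesses *)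

(** The cards in positions [t] and later are permuted among themselves. *)
Lemma swap_same_counts s (i j : 'I_(m1 + m2)) t : t <= i -> t <= j ->
  same_counts t s (tperm i j * s)%g.
Proof.
move=> t_i t_j.
suff E c : remaining (tperm i j * s)%g t c = remaining s t c.
  by rewrite /same_counts !E !eqxx.
rewrite /remaining -[RHS](card_preim_perm (tperm i j)).
apply: eq_card => x; rewrite !inE /drawn_colour permM; congr (_ && _).
by case: tpermP => // ->; rewrite t_i t_j.
Qed.

Lemma swap_history s (i j : 'I_(m1 + m2)) : i <= j ->
  history (tperm i j * s)%g i = history s i.
Proof.
move=> i_j; rewrite /history -!(map_take _ (drawn_colour _)).
apply/eq_in_map => x x_i.
have {}x_i := mem_take_enum x_i.
by rewrite /drawn_colour permM tpermD // -val_eqE /= neq_ltn; apply/orP; lia.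
Qed.

Variable tie : seq colour -> colour.

Lemma same_counts_refl t s : same_counts t s s.
Proof. by rewrite /same_counts !eqxx. Qed.

Lemma drawn_remaining s (i : 'I_(m1 + m2)) :
  0 < remaining s i (drawn_colour s i).
Proof. by apply/card_gt0P; exists i; rewrite inE leqnn eqxx. Qed.

Lemma guess_same_counts s s' (i : 'I_(m1 + m2)) : same_counts i s s' ->
  history s' i = history s i -> guess tie s' i = guess tie s i.
Proof. by rewrite /guess => /andP[/eqP-> /eqP->] ->. Qed.

(** If both colours remain, some card not yet drawn has the colour that is not
    guessed; moving it to position [i] keeps everything the guess depends on,
    so the guess fails for a deck with the same counts. *)
Lemma sure_guessE s i :
  correct tie s i && (success_prob tie s i == 1%R) =
    one_colour (drop i (colour_word s)).
Proof.
rewrite /one_colour -!remainingE.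
have Fs := same_counts_refl i s.
apply/andP/idP => [[_ /(cond_prob1P _ Fs) sure]|mono].
  rewrite -[_ || _]negbK negb_or -!lt0n; apply/negP => /andP[r_gt0 b_gt0].
  have /card_gt0P[j] : 0 < remaining s i (~~ guess tie s i).
    by case: (guess tie s i).
  rewrite inE => /andP[i_j /eqP draw_j].
  have sc := swap_same_counts s (leqnn i) i_j.
  have := sure _ sc.
  rewrite /correct (guess_same_counts sc (swap_history s i_j)).
  by rewrite /drawn_colour permM tpermL -/(drawn_colour s j) draw_j; case: guess.
have ok s' : same_counts i s s' -> correct tie s' i.
  rewrite /same_counts => /andP[/eqP Er /eqP Eb]; rewrite -Er -Eb in mono.
  have := drawn_remaining s' i; rewrite /correct /guess.
  by case: drawn_colour; case/orP: mono => /eqP-> // ->.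
by split; [exact: (ok _ Fs)|exact/(cond_prob1P _ Fs)].
Qed.

Lemma T_word s : T tie s = nb_suffixes one_colour (colour_word s).
Proof.
rewrite nb_suffixesE size_tuple /T -sum1dep_card big_mkcond /=.
by apply: eq_bigr => i _; rewrite sure_guessE; case: one_colour.
Qed.

(** [W] also looks at the empty deck, which is not a tie with cards left. *)
Lemma W_word s : W s = nb_suffixes balanced (colour_word s).
Proof.
rewrite nb_suffixesE size_tuple /W -sum1dep_card big_mkcond /= big_ord_recr /=.
rewrite !remainingE drop_oversize ?size_tuple //= addn0.
by apply: eq_bigr => i _; rewrite !remainingE /balanced; case: (_ && _).
Qed.

(** * Equidistribution of the colour words *)

(** A permutation [p] of the positions that turns one word into the other maps
    the decks of one fibre bijectively to those of the other, as [s |-> p * s]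
    only rearranges the positions of [s]. *)
Lemma card_fibre (w : (m1 + m2).-tuple colour) : tval w \in words m1 m2 ->
  #|[set s | colour_word s == w]| =
    #|[set s | colour_word s == colour_word 1%g]|.
Proof.
rewrite mem_words => /andP[/eqP w_red /eqP w_black].
have /andP[/eqP v_red /eqP v_black] := count_colour_word 1%g.
have /tuple_permP[p w_p] : perm_eq w (colour_word 1%g).
  by apply/allP => -[] _ /=; rewrite ?w_red ?w_black ?v_red ?v_black.
rewrite -[RHS](card_imset _ (mulgI p)); apply: eq_card => s.
apply/idP/imsetP; rewrite inE.
  move=> /eqP s_w; exists (p^-1 * s)%g; last by rewrite mulKVg.
  rewrite inE; apply/eqP/eq_from_tnth => i.
  rewrite tnth_colour_word /drawn_colour permM -[i in RHS](permKV p).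
  rewrite -/(drawn_colour s _) -tnth_colour_word s_w (val_inj w_p).
  by rewrite tnth_mktuple.
case=> s1; rewrite inE => /eqP s1_1 ->.
apply/eqP/val_inj; rewrite /= w_p; apply: eq_map => i.
by rewrite -s1_1 tnth_mktuple /drawn_colour permM.
Qed.

Lemma card_colour_word (P : pred (seq colour)) :
  #|[set s : deck m1 m2 | P (colour_word s)]| =
    count P (words m1 m2) *
      #|[set s : deck m1 m2 | colour_word s == colour_word 1%g]|.
Proof.
pose Pwords := [seq w <- words m1 m2 | P w].
transitivity (\sum_(w <- Pwords) \sum_(s | tval (colour_word s) == w) 1).
  rewrite (exchange_big_dep predT) //= -sum1dep_card big_mkcond /=.
  apply: eq_bigr => s _; rewrite sum1_count.
  rewrite (eq_count (a2 := pred1 (tval (colour_word s)))) => [|w];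
    last exact: eq_sym.
  rewrite count_uniq_mem ?filter_uniq ?words_uniq // mem_filter mem_words.
  by rewrite count_colour_word andbT; case: (P _).
rewrite -size_filter -sum1_size big_distrl /= [LHS]big_seq [RHS]big_seq.
apply: eq_bigr => w; rewrite mem_filter mul1n => /andP[_ w_in].
have /eqP size_w := size_in_words w_in.
by rewrite sum1dep_card (@card_fibre (Tuple size_w)).
Qed.

(** The common size of the fibres cancels, so it is never computed. *)
Lemma prob_colour_word (P : pred (seq colour)) :
  prob (fun s : deck m1 m2 => P (colour_word s)) =
    ((count P (words m1 m2))%:R / 'C(m1 + m2, m1)%:R)%R.
Proof.
rewrite /prob card_colour_word.
have -> :
    #|deck m1 m2| = #|[set s : deck m1 m2 | predT (tval (colour_word s))]|.
  by apply: eq_card => s; rewrite inE.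
rewrite card_colour_word count_predT size_words !natrM -mulf_div divff ?mulr1 //.
rewrite pnatr_eq0 -lt0n; apply/card_gt0P; exists 1%g.
by rewrite inE.
Qed.

End ColourWord.

(** * The two laws *)

Lemma eq_prob (S : finType) (E F : pred S) : E =1 F -> prob E = prob F.
Proof.
move=> EF; rewrite /prob; congr (_%:R / _)%R.
by apply: eq_card => x; rewrite !inE.
Qed.

Lemma prob_pred0 (S : finType) (E : pred S) : E =1 pred0 -> prob E = 0%R.
Proof.
move=> E0; rewrite /prob (eq_card (B := pred0)) ?card0 ?mul0r // => x.
by rewrite inE E0.
Qed.

Lemma prob_T m1 m2 tie l :
  prob (fun s : deck m1 m2 => T tie s == l) =
    ((count (fun w => nb_suffixes one_colour w == l) (words m1 m2))%:R
      / 'C(m1 + m2, m1)%:R)%R.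
Proof.
by rewrite -prob_colour_word; apply: eq_prob => s; rewrite T_word.
Qed.

Lemma prob_W m1 m2 k :
  prob (fun s : deck m1 m2 => W s == k) =
    (((nb_words_ge k m1 m2)%:R - (nb_words_ge k.+1 m1 m2)%:R)
      / 'C(m1 + m2, m1)%:R)%R.
Proof.
pose P w := nb_suffixes balanced w == k.
rewrite (eq_prob (F := fun s => P (colour_word s))) => [|s];
  last by rewrite W_word.
rewrite prob_colour_word; congr (_ / _)%R.
apply/eqP; rewrite eq_sym subr_eq -natrD eqr_nat /nb_words_ge; apply/eqP.
elim: words => //= w ws ->; rewrite /P; lia.
Qed.

Theorem corollary1 (m1 m2 : nat) (tie : seq colour -> colour)
    (le_m2_m1 : m2 <= m1) :
  [/\ forall l : nat, l <= m1 ->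
        prob (fun s : deck m1 m2 => T tie s == l) =
        (if ((1 <= m2) && (1 <= l))%N then
           ('C((m1 + m2 - l - 1)%N, (m2 - 1)%N)%:R
              + 'C((m1 + m2 - l - 1)%N, (m1 - 1)%N)%:R)
             / 'C((m1 + m2)%N, m1)%:R
         else if (m2 == 0%N) && (l == m1) then 1
         else 0)%R,
      forall l : int, ~~ (0 <= l <= m1%:Z)%R ->
        prob (fun s : deck m1 m2 => (T tie s)%:Z == l)%R = 0%R,
      forall k : nat, k <= m2 ->
        prob (fun s : deck m1 m2 => W s == k) =
        (if (1 <= m1)%N then
           (2 ^+ k * 'C((m1 + m2 - k)%N, m1)%:R
              - 2 ^+ k.+1 * 'C((m1 + m2 - k - 1)%N, m1)%:R)
             / 'C((m1 + m2)%N, m1)%:R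
         else if [&& m1 == 0%N, m2 == 0%N & k == 0%N] then 1
         else 0)%R
    & forall k : int, ~~ (0 <= k <= m2%:Z)%R ->
        prob (fun s : deck m1 m2 => (W s)%:Z == k)%R = 0%R].
Proof.
split.
- move=> l l_le; rewrite prob_T.
  case: m2 le_m2_m1 => [_|n n_le] /=.
    rewrite count_words0r nb_one_colour_nseq addn0 binn divr1 eq_sym.
    by case: eqP.
  case: l l_le => [_|l l_le] /=.
    rewrite (eq_in_count (a2 := pred0)) ?count_pred0 ?mul0r // => w w_in.
    by rewrite gtn_eqF // nb_one_colour_gt0 // (size_in_words w_in) addnS.
  rewrite count_one_colour //; last lia.
  rewrite natrD; congr ((_%:R + _%:R) / _)%R.
    rewrite /= l_le mul1n !subn1; congr 'C(_, _); lia.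
  (* A black run longer than [m2] is impossible; its binomial vanishes too. *)
  case: m1 l_le n_le => // m l_le n_le /=.
  have [l_n|n_l] := leqP l.+1 n.+1.
    rewrite mul1n subn1; congr 'C(_, _); lia.
  by rewrite [RHS]bin_small //; lia.
- case=> l out; last by apply: prob_pred0.
  rewrite (eq_prob (F := fun s => T tie s == l)) // prob_T.
  have {}out : m1 < l by move: out; lia.
  suff -> : count (fun w => nb_suffixes one_colour w == l) (words m1 m2) = 0.
    by rewrite mul0r.
  case: (posnP (m1 + m2)) => [/eqP|m_gt0].
    rewrite addn_eq0 => /andP[/eqP m1_0 /eqP m2_0].
    by rewrite m1_0 m2_0 /= eq_sym gtn_eqF //; lia.
  by rewrite count_one_colour ?final_run_small //; lia.
- move=> k k_le; rewrite prob_W; case: posnP => [m1_0|m1_gt0].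
    have m2_0 : m2 = 0 by lia.
    have k_0 : k = 0 by lia.
    by subst m1 m2 k.
  by rewrite !nb_words_geE // !natrM !natrX subnS subn1.
- case=> k out; last by apply: prob_pred0.
  rewrite (eq_prob (F := fun s => W s == k)) // prob_W.
  have {}out : m2 < k by move: out; lia.
  case: (posnP m1) => [m1_0|m1_gt0].
    have m2_0 : m2 = 0 by lia.
    by rewrite m1_0 m2_0 /nb_words_ge !count_words0l; case: k out.
  have no_words j : m2 < j -> nb_words_ge j m1 m2 = 0.
    by move=> j_gt; rewrite nb_words_geE // bin_small ?muln0 //; lia.
  by rewrite !no_words ?subrr ?mul0r // ltnW.
Qed.
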